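(* Let $F:\mathcal{P}_1(\mathbb{R})\to\mathbb{R}$ be continuous. Assume that there exists $H:\mathcal{P}_1(\mathbb{R})\times\mathbb{R}\to\mathbb{R}$ of class $C^{0,1}$ such that, for any $K>0$: (i) $F$ is Lipschitz continuous on $\mathcal{P}([-K,K])$ (with respect to $W_1$); (ii) $F$ is uniformly Dawson-differentiable on $\mathcal{P}([-K,K])\times[-K,K]$ with derivative $H$, that is, as $\varepsilon>0$ tends to $0$, $$\sup_{x\in[-K,K],\,m\in\mathcal{P}([-K,K])}\left|\frac1\varepsilon\left(F((1-\varepsilon)m+\varepsilon\delta_x)-F(m)\right)-H(m,x)\right|\longrightarrow 0;$$ (iii) for all $m\in\mathcal{P}([-K,K])$, $\int_{\mathbb{R}}H(m,x)\,dm(x)=0$. Then $F$ is differentiable on $\mathcal{P}_1(\mathbb{R})$ and, for all $m\in\mathcal{P}_1(\mathbb{R})$ and $x\in\mathbb{R}$, $$\delta F(m,x)=H(m,x).$$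
   Context: $\mathcal{P}_1(\mathbb{R})$ is the space of probability measures on $\mathbb{R}$ with finite first moment, endowed with the Wasserstein metric $W_1$ of order one. For $K>0$, $\mathcal{P}([-K,K])\subseteq\mathcal{P}_1(\mathbb{R})$ is the subspace of measures supported in $[-K,K]$. $\delta_x$ denotes the Dirac mass at $x$. Differentiability (linear functional derivative): $F:\mathcal{P}_1(\mathbb{R})\to\mathbb{R}$ is differentiable if there is $H:\mathcal{P}_1(\mathbb{R})\times\mathbb{R}\to\mathbb{R}$, measurable and sublinear in the real variable uniformly over the measure variable in any given compact subset of $\mathcal{P}_1(\mathbb{R})$ (i.e. for each compact $\mathcal{K}\subseteq\mathcal{P}_1(\mathbb{R})$ there is $C>0$ with $|H(m,x)|\le C(1+|x|)$ for all $m\in\mathcal{K}$, $x\in\mathbb{R}$), such that for all $m,m_0\in\mathcal{P}_1(\mathbb{R})$, $$F(m)-F(m_0)=\int_0^1\int_{\mathbb{R}}H((1-t)m_0+t\,m,x)\,d(m-m_0)(x)\,dt.$$ Such an $H$ is called a version of the derivative of $F$. The canonical derivative, denoted $\delta F$, is the version satisfying in addition $\int_{\mathbb{R}}H(\mu,x)\,d\mu(x)=0$ for all $\mu\in\mathcal{P}_1(\mathbb{R})$. Thus ''$F$ is differentiable with $\delta F=H$'' means that $H$ is a version of the derivative of $F$ satisfying this canonical condition. Class $C^{0,1}$: $G:\mathcal{P}_1(\mathbb{R})\times\mathbb{R}\to\mathbb{R}$ is $C^{0,1}$ if it is $C^1$ in $x$ for fixed $m$, continuous in $m$ for fixed $x$,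 sublinear in $x$ uniformly over $m$ in any compact set (in the sense above), and $(m,x)\mapsto\partial_xG(m,x)$ is jointly continuous. *)

(* Defs.v *)
From HB Require Import structures.
From mathcomp Require Import all_boot all_order all_algebra.
From mathcomp Require Import all_classical all_reals all_analysis.
From mathcomp Require Import measurable_realfun.

Set Implicit Arguments.
Unset Strict Implicit.
Unset Printing Implicit Defensive.
Import Order.TTheory GRing.Theory Num.Theory.
Import numFieldNormedType.Exports.

Local Open Scope classical_set_scope.
Local Open Scope ring_scope.

Record P1 (R : realType) := MkP1 {
  P1_prob :> probability (measurableTypeR R) R ;
  P1_moment1 : (\int[P1_prob]_x `|x|%:E < +oo)%E }.

Section P1_dirac.
Variables (R : realType) (a : R).

Let pdirac : probability (measurableTypeR R) R :=
  (\d_(a : measurableTypeR R) : set (measurableTypeR R) -> \bar R).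

Lemma dirac_moment1 : (\int[pdirac]_x `|x|%:E < +oo)%E.
Proof.
rewrite integral_dirac//; first by rewrite diracT mul1e ltry.
by apply/measurable_EFinP; exact: normr_measurable.
Qed.

Definition P1_dirac : P1 R := MkP1 dirac_moment1.

End P1_dirac.

HB.instance Definition _ (R : realType) := gen_eqMixin (P1 R).
HB.instance Definition _ (R : realType) := gen_choiceMixin (P1 R).
HB.instance Definition _ (R : realType) := isPointed.Build (P1 R) (P1_dirac 0).

Definition coupling (R : realType) (m n : P1 R) :
    set (probability (measurableTypeR R * measurableTypeR R)%type R) :=
  [set g | forall A : set (measurableTypeR R), measurable A ->
     g (A `*` setT) = m A /\ g (setT `*` A) = n A].

(* Extended-real valued so that no finiteness proof is needed; the product
   coupling shows that it is finite on [P1 R]. *)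
Definition W1 (R : realType) (m n : P1 R) : \bar R :=
  ereal_inf [set (\int[g]_p `|p.1 - p.2|%:E)%E | g in coupling m n].

(* The topology of [P1 R] is the metric topology of [W1]. *)
Section W1_topology.
Variable R : realType.

Definition W1_open : set_system (P1 R) :=
  [set A | forall m, A m ->
     exists2 e : R, 0 < e & [set n | (W1 m n < e%:E)%E] `<=` A].

Lemma W1_openT : W1_open setT.
Proof. by move=> m _; exists 1. Qed.

Lemma W1_openI : setI_closed W1_open.
Proof.
move=> A B oA oB m [/oA[e e0 eA] /oB[d d0 dB]].
exists (Num.min e d); first by rewrite lt_min e0.
move=> n /= mn; split; [apply: eA|apply: dB];
  by apply: lt_le_trans mn _; rewrite lee_fin ge_min lexx ?orbT.
Qed.

Lemma W1_open_bigU (I : Type) (f : I -> set (P1 R)) :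
  (forall i, W1_open (f i)) -> W1_open (\bigcup_i f i).
Proof.
move=> fo m [i _ /fo[e e0 ef]]; exists e => // n /ef fin.
by exists i.
Qed.

HB.instance Definition _ :=
  isOpenTopological.Build (P1 R) W1_openT W1_openI W1_open_bigU.

End W1_topology.

(* [mix t m n] is the measure (1 - t) m + t n.  The weight is clamped to [0, 1]
   so that [mix] is total in [t : R]; only 0 <= t <= 1 is meaningful. *)
Section mix.
Variables (R : realType) (t : R) (m n : P1 R).

Definition clamp01 : R := Num.max 0 (Num.min 1 t).

Lemma clamp01_ge0 : 0 <= clamp01.
Proof. by rewrite /clamp01 le_max lexx. Qed.

Lemma clamp01_onem_ge0 : 0 <= 1 - clamp01.
Proof. by rewrite subr_ge0 /clamp01 ge_max ler01 ge_min lexx. Qed.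

Definition mix_measure : set (measurableTypeR R) -> \bar R :=
  measure_add (mscale (NngNum clamp01_onem_ge0) m)
              (mscale (NngNum clamp01_ge0) n).

HB.instance Definition _ := Measure.on mix_measure.

Lemma mix_measureT : mix_measure setT = 1%E.
Proof.
rewrite /mix_measure measure_addE/= /mscale/= (probability_setT m) (probability_setT n) !mule1.
by rewrite -EFinD subrK.
Qed.

HB.instance Definition _ :=
  Measure_isProbability.Build _ _ _ mix_measure mix_measureT.

Lemma mix_moment1 : (\int[mix_measure]_x `|x|%:E < +oo)%E.
Proof.
have mabs : measurable_fun [set: measurableTypeR R] (fun x => `|x|%:E : \bar R).
  by apply/measurable_EFinP; exact: normr_measurable.
rewrite ge0_integral_measure_add//.
rewrite !ge0_integral_mscale//=.
apply: lte_add_pinfty; apply: lte_mul_pinfty => //; try exact: P1_moment1.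
  by rewrite lee_fin clamp01_onem_ge0.
by rewrite lee_fin clamp01_ge0.
Qed.

Definition mix : P1 R := MkP1 mix_moment1.

Lemma mixE (A : set (measurableTypeR R)) : 0 <= t <= 1 ->
  mix A = ((1 - t)%:E * m A + t%:E * n A)%E.
Proof.
move=> /andP[t0 t1]; rewrite /= /mix_measure measure_addE/= /mscale/=.
by rewrite /clamp01 (min_idPr t1) (max_idPr t0).
Qed.

End mix.

Definition P1_supported (R : realType) (K : R) : set (P1 R) :=
  [set m | m (~` `[- K, K]%classic) = 0%E].

Definition W1_lipschitz_on (R : realType) (A : set (P1 R)) (F : P1 R -> R) :=
  exists2 L : R, 0 <= L & forall m n, A m -> A n ->
    (`|F m - F n|%:E <= L%:E * W1 m n)%E.

Definition sublinear_on_compacts (R : realType) (H : P1 R -> R -> R) :=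
  forall A : set (P1 R), compact A ->
    exists2 C : R, 0 < C & forall m x, A m -> `|H m x| <= C * (1 + `|x|).

Definition class_C01 (R : realType) (G : P1 R -> R -> R) :=
  [/\ forall m, (forall x : R, derivable (G m) x 1) /\ continuous (derive1 (G m)),
      forall x, continuous (fun m => G m x),
      sublinear_on_compacts G &
      continuous (fun p : P1 R * R => derive1 (G p.1) p.2)].

(* Measurability is joint, for the Borel sigma-algebra of the product space.
   With sublinearity this makes the inner integrals finite and the integrand in
   [t] measurable and bounded. *)
Definition derivative_version (R : realType) (F : P1 R -> R)
    (H : P1 R -> R -> R) :=
  [/\ measurable_fun [set: g_sigma_algebraType (@open (P1 R * R)%type)]
        (fun p => H p.1 p.2 : measurableTypeR R),
      sublinear_on_compacts H &
      forall m m0 : P1 R,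
        (F m - F m0)%:E =
        (\int[lebesgue_measure]_(t in `[0%R, 1%R])
          (\int[m]_x (H (mix t m0 m) x)%:E
           - \int[m0]_x (H (mix t m0 m) x)%:E))%E].

Definition canonical_derivative (R : realType) (F : P1 R -> R)
    (H : P1 R -> R -> R) :=
  derivative_version F H /\
  forall m : P1 R, (\int[m]_x (H m x)%:E = 0)%E.

Definition uniformly_dawson_differentiable (R : realType) (K : R)
    (F : P1 R -> R) (H : P1 R -> R -> R) :=
  ereal_sup
    [set `|e^-1 * (F (mix e p.1 (P1_dirac p.2)) - F p.1) - H p.1 p.2|%:E
      | p in P1_supported K `*` `[- K, K]%classic]
    @[e --> (0 : R)^'+] --> 0%E.

(* Main.v *)
(* If m0 and m are finitely supported, adding the atoms of m one at a time to
   m_t = (1 - t) m0 + t m turns Dawson differentiability into the one-sided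
   derivative of F at m_t in the direction of m; likewise for m0.  Since
   H(m_t, .) is centred under m_t, both one-sided derivatives of t |-> F(m_t)
   equal the integral of H(m_t, .) against m - m0, and the fundamental theorem
   of calculus gives the formula.  For general m0 and m, push both forward by
   finite-range maps T_n -> id with |T_n x| <= |x|, and pass to the limit by
   dominated convergence: the mixtures of the approximants and of their limits
   form a compact set, on which H is uniformly sublinear.  The W1 distances
   involved are bounded by explicit couplings. *)
From HB Require Import structures.
Require Import Defs.
From mathcomp Require Import all_boot all_order all_algebra.
From mathcomp Require Import all_classical all_reals all_analysis.
From mathcomp Require Import measurable_realfun ring lra.

Set Implicit Arguments.
Unset Strict Implicit.
Unset Printing Implicit Defensive.
Import Order.TTheory GRing.Theory Num.Theory.
Import numFieldNormedType.Exports.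

Local Open Scope classical_set_scope.
Local Open Scope ring_scope.

(** * Couplings and the topology of W1 *)

Lemma P1_setT (R : realType) (m : P1 R) : m setT = 1%E.
Proof. exact: (probability_setT m). Qed.

Section coupling_of_mixtures.
Local Open Scope ereal_scope.
Context {R : realType} (m0 m : P1 R) (T T' : measurableTypeR R -> measurableTypeR R).
Hypotheses (mT : measurable_fun setT T) (mT' : measurable_fun setT T').
Variables (w0 w1 w2 : {nonneg R}) (w_sum : (w0%:num + w1%:num + w2%:num = 1)%R).

Let RR := (measurableTypeR R * measurableTypeR R)%type.

Definition P1_prod : set RR -> \bar R := m0 \x m.

HB.instance Definition _ := Measure.on P1_prod.

Lemma P1_prodX (A B : set (measurableTypeR R)) : measurable A -> measurable B ->
  P1_prod (A `*` B) = m0 A * m B.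
Proof. exact: product_measure1E. Qed.

Let P1_prodT : P1_prod setT = 1.
Proof.
by rewrite -setXTT P1_prodX// !P1_setT mule1.
Qed.

HB.instance Definition _ := Measure_isProbability.Build _ _ _ P1_prod P1_prodT.

Definition map_diag (x : measurableTypeR R) : RR := (T x, T' x).
Definition map_prod (p : RR) : RR := (T p.1, T' p.2).

Let measurable_map_diag : measurable_fun setT map_diag.
Proof. exact: measurable_fun_pair. Qed.

Let measurable_map_prod : measurable_fun setT map_prod.
Proof.
apply: measurable_fun_pair; apply: measurableT_comp => //.
Qed.

HB.instance Definition _ :=
  isMeasurableFun.Build _ _ (measurableTypeR R) RR map_diag measurable_map_diag.
HB.instance Definition _ :=
  isMeasurableFun.Build _ _ RR RR map_prod measurable_map_prod.

(* The part of the mass common to both mixtures is moved along [T x |-> T' x];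
   the mass [w2] that changes from [m0] to [m] is coupled independently. *)
Definition mixture_coupling : set RR -> \bar R :=
  measure_add (mscale w0 (distribution m0 map_diag))
    (measure_add (mscale w1 (distribution m map_diag))
                 (mscale w2 (distribution P1_prod map_prod))).

HB.instance Definition _ := Measure.on mixture_coupling.

Lemma mixture_couplingE A : mixture_coupling A =
  w0%:num%:E * m0 (map_diag @^-1` A) + (w1%:num%:E * m (map_diag @^-1` A)
  + w2%:num%:E * P1_prod (map_prod @^-1` A)).
Proof. by rewrite /mixture_coupling measure_addE; congr (_ + _); exact: measure_addE. Qed.

Let mixture_couplingT : mixture_coupling setT = 1.
Proof.
rewrite mixture_couplingE !preimage_setT !P1_setT P1_prodT !mule1.
by rewrite -!EFinD addrA w_sum.
Qed.

HB.instance Definition _ :=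
  Measure_isProbability.Build _ _ _ mixture_coupling mixture_couplingT.

Definition mixture_coupling_prob : probability RR R := mixture_coupling.

(** The mass [w2] counts with [m0] in the first marginal and with [m] in the second, so the total
    weight of [m] grows from [w1] to [w1 + w2]. *)
Lemma mixture_coupling_fst A : measurable A ->
  mixture_coupling (A `*` setT) =
  w0%:num%:E * m0 (T @^-1` A) + (w1%:num%:E * m (T @^-1` A)
  + w2%:num%:E * m0 (T @^-1` A)).
Proof.
move=> mA; have mTA : measurable (T @^-1` A) by rewrite -[X in measurable X]setTI; exact: mT.
rewrite mixture_couplingE.
have -> : map_diag @^-1` (A `*` setT) = T @^-1` A.
  by apply/seteqP; split => x //= [].
have -> : map_prod @^-1` (A `*` setT) = (T @^-1` A) `*` setT.
  by apply/seteqP; split => x //= [].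
by rewrite P1_prodX// P1_setT mule1.
Qed.

Lemma mixture_coupling_snd A : measurable A ->
  mixture_coupling (setT `*` A) =
  w0%:num%:E * m0 (T' @^-1` A) + (w1%:num%:E * m (T' @^-1` A)
  + w2%:num%:E * m (T' @^-1` A)).
Proof.
move=> mA; have mTA : measurable (T' @^-1` A) by rewrite -[X in measurable X]setTI; exact: mT'.
rewrite mixture_couplingE.
have -> : map_diag @^-1` (setT `*` A) = T' @^-1` A.
  by apply/seteqP; split => x //= [].
have -> : map_prod @^-1` (setT `*` A) = setT `*` (T' @^-1` A).
  by apply/seteqP; split => x //= [].
by rewrite P1_prodX// P1_setT mul1e.
Qed.

Lemma integral_mixture_coupling (f : RR -> \bar R) :
  measurable_fun setT f -> (forall p, 0 <= f p) ->
  \int[mixture_coupling]_p f p =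
  w0%:num%:E * (\int[m0]_x f (T x, T' x)) + (w1%:num%:E * (\int[m]_x f (T x, T' x))
  + w2%:num%:E * \int[P1_prod]_p f (T p.1, T' p.2)).
Proof.
move=> mf f0; rewrite /mixture_coupling ge0_integral_measure_add//; congr (_ + _).
  rewrite ge0_integral_mscale//; congr (_ * _); exact: ge0_integral_distribution.
rewrite ge0_integral_measure_add//; congr (_ + _).
  rewrite ge0_integral_mscale//; congr (_ * _); exact: ge0_integral_distribution.
rewrite ge0_integral_mscale; [|exact: measurableT|exact: mf|by move=> p _; exact: f0].
by rewrite ge0_integral_distribution; [|exact: mf|exact: f0].
Qed.

Lemma ge0_integral_P1_prod_fst (f : measurableTypeR R -> \bar R) :
  measurable_fun setT f -> (forall x, 0 <= f x) ->
  \int[P1_prod]_p f p.1 = \int[m0]_x f x.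
Proof.
move=> mf f0.
have := @ge0_integral_pushforward _ _ _ _ R fst (@measurable_fst _ _ _ _) P1_prod setT f
  measurableT mf.
rewrite preimage_setT => <-; last by move=> ? _; exact: f0.
apply: eq_measure_integral => A mA _; change (P1_prod (fst @^-1` A) = m0 A).
rewrite (_ : fst @^-1` A = A `*` (@setT (measurableTypeR R))).
  by rewrite P1_prodX// P1_setT mule1.
by apply/seteqP; split => x //= [].
Qed.

Lemma ge0_integral_P1_prod_snd (f : measurableTypeR R -> \bar R) :
  measurable_fun setT f -> (forall x, 0 <= f x) ->
  \int[P1_prod]_p f p.2 = \int[m]_x f x.
Proof.
move=> mf f0.
have := @ge0_integral_pushforward _ _ _ _ R snd (@measurable_snd _ _ _ _) P1_prod setT f
  measurableT mf.
rewrite preimage_setT => <-; last by move=> ? _; exact: f0.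
apply: eq_measure_integral => A mA _; change (P1_prod (snd @^-1` A) = m A).
rewrite (_ : snd @^-1` A = (@setT (measurableTypeR R)) `*` A).
  by rewrite P1_prodX// P1_setT mul1e.
by apply/seteqP; split => x //= [].
Qed.

End coupling_of_mixtures.

Section W1_bound.
Local Open Scope ereal_scope.
Context {R : realType} (T T' : measurableTypeR R -> measurableTypeR R).
Hypotheses (mT : measurable_fun setT T) (mT' : measurable_fun setT T').
Hypotheses (T_le : forall x, (`|T x| <= `|x|)%R) (T'_le : forall x, (`|T' x| <= `|x|)%R).

(** Use the coupling with weights [1 - t'], [t] and [t' - t]. The common mass costs the integrals of
    [|T x - T' x|], with weights at most 1. The independently coupled mass costs at most
    [|x| + |y|], because [T] and [T'] do not increase absolute values. *)
Let W1_mixture_le_ordered (m0 m mu nu : P1 R) (t t' : R) :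
  (0 <= t)%R -> (t <= t')%R -> (t' <= 1)%R ->
  (forall A, measurable A ->
    mu A = (1 - t)%:E * m0 (T @^-1` A) + t%:E * m (T @^-1` A)) ->
  (forall A, measurable A ->
    nu A = (1 - t')%:E * m0 (T' @^-1` A) + t'%:E * m (T' @^-1` A)) ->
  W1 mu nu <= (\int[m0]_x `|T x - T' x|%:E + \int[m]_x `|T x - T' x|%:E)
    + (t' - t)%:E * (\int[m0]_x `|x|%:E + \int[m]_x `|x|%:E).
Proof.
move=> t0 tt' t'1 muE nuE.
have t'0 : (0 <= t')%R by exact: le_trans tt'.
have w0P : (0 <= 1 - t')%R by rewrite subr_ge0.
have w2P : (0 <= t' - t)%R by rewrite subr_ge0.
pose w0 := NngNum w0P; pose w1 := NngNum t0; pose w2 := NngNum w2P.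
have w_sum : (w0%:num + w1%:num + w2%:num = 1)%R by rewrite /=; ring.
pose g := mixture_coupling_prob m0 m mT mT' w_sum.
have m0fin A : measurable A -> m0 A \is a fin_num by move=> ?; exact: fin_num_measure.
have mfin A : measurable A -> m A \is a fin_num by move=> ?; exact: fin_num_measure.
have gc : coupling mu nu g.
  move=> A mA; split.
    rewrite [LHS]mixture_coupling_fst// muE//=.
    have mTA : measurable (T @^-1` A) by rewrite -[X in measurable X]setTI; exact: mT.
    rewrite -(fineK (m0fin _ mTA)) -(fineK (mfin _ mTA)) -!EFinM -!EFinD.
    by congr (_%:E); ring.
  rewrite [LHS]mixture_coupling_snd// nuE//=.
  have mTA : measurable (T' @^-1` A) by rewrite -[X in measurable X]setTI; exact: mT'.
  rewrite -(fineK (m0fin _ mTA)) -(fineK (mfin _ mTA)) -!EFinM -!EFinD.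
  by congr (_%:E); ring.
have mabs : measurable_fun [set: measurableTypeR R] (fun x => `|x|%:E : \bar R).
  by apply/measurable_EFinP; exact: normr_measurable.
have mcost : measurable_fun [set: measurableTypeR R * measurableTypeR R]
    (fun p => `|p.1 - p.2|%:E : \bar R).
  apply/measurable_EFinP/measurableT_comp => //.
  by apply: measurable_funB; [exact: measurable_fst|exact: measurable_snd].
apply: (@le_trans _ _ (\int[g]_p `|p.1 - p.2|%:E)).
  by apply: ereal_inf_lbound; exists g.
rewrite [leLHS]integral_mixture_coupling//= addeA.
have I0 (n : P1 R) : 0 <= \int[n]_x `|T x - T' x|%:E by apply: integral_ge0.
apply: leeD; first apply: leeD.
- by rewrite -[leRHS]mul1e; apply: lee_wpmul2r => //; rewrite lee_fin; lra.
- by rewrite -[leRHS]mul1e; apply: lee_wpmul2r => //; rewrite lee_fin; lra.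
apply: lee_wpmul2l; first by rewrite lee_fin.
rewrite -(@ge0_integral_P1_prod_fst _ m0 m _ mabs)//.
rewrite -(@ge0_integral_P1_prod_snd _ m0 m _ mabs)//.
rewrite -ge0_integralD//; last 2 first.
- by apply: (measurableT_comp mabs); exact: measurable_fst.
- by apply: (measurableT_comp mabs); exact: measurable_snd.
apply: ge0_le_integral => //.
- apply/measurable_EFinP/measurableT_comp => //.
  by apply: measurable_funB; apply: measurableT_comp.
- by apply: emeasurable_funD; apply: (measurableT_comp mabs);
    [exact: measurable_fst|exact: measurable_snd].
- move=> p _; rewrite -EFinD lee_fin; apply: (le_trans (ler_normB _ _)).
  exact: lerD.
Qed.

Lemma W1_mixture_le (m0 m mu nu : P1 R) (t t' : R) : (0 <= t <= 1)%R -> (0 <= t' <= 1)%R ->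
  (forall A, measurable A ->
    mu A = (1 - t)%:E * m0 (T @^-1` A) + t%:E * m (T @^-1` A)) ->
  (forall A, measurable A ->
    nu A = (1 - t')%:E * m0 (T' @^-1` A) + t'%:E * m (T' @^-1` A)) ->
  W1 mu nu <= (\int[m0]_x `|T x - T' x|%:E + \int[m]_x `|T x - T' x|%:E)
    + `|t' - t|%:E * (\int[m0]_x `|x|%:E + \int[m]_x `|x|%:E).
Proof.
move=> /andP[t0 t1] /andP[t'0 t'1] muE nuE; have [tt'|/ltW t't] := leP t t'.
  by rewrite ger0_norm ?subr_ge0//; exact: W1_mixture_le_ordered.
(* For [t' <= t], exchange [m0] and [m] and replace the weights by [1 - t] and [1 - t']. *)
have -> : (`|t' - t| = (1 - t') - (1 - t))%R by rewrite ler0_norm ?subr_le0//; ring.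
rewrite [X in X + _]addeC [X in _ + _ * X]addeC.
apply: W1_mixture_le_ordered; try lra.
- by move=> A mA; rewrite muE// addeC subKr.
- by move=> A mA; rewrite nuE// addeC subKr.
Qed.

End W1_bound.

Lemma measurable_normr_EFin (R : realType) :
  measurable_fun [set: measurableTypeR R] (fun x => `|x|%:E : \bar R).
Proof. by apply/measurable_EFinP; exact: normr_measurable. Qed.

Lemma integrable_normr (R : realType) (m : P1 R) :
  m.-integrable setT (fun x => `|x|%:E).
Proof.
apply/integrableP; split; first exact: measurable_normr_EFin.
by under eq_integral do rewrite /= normr_id; exact: P1_moment1.
Qed.

Section P1_push.
Context {R : realType} (T : measurableTypeR R -> measurableTypeR R).
Hypotheses (mT : measurable_fun setT T) (T_le : forall x, `|T x| <= `|x|).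
Variable m : P1 R.

HB.instance Definition _ :=
  isMeasurableFun.Build _ _ (measurableTypeR R) (measurableTypeR R) T mT.

Let push_prob : probability (measurableTypeR R) R := distribution m T.

Let push_moment1 : (\int[push_prob]_x `|x|%:E < +oo)%E.
Proof.
rewrite ge0_integral_distribution//; last exact: measurable_normr_EFin.
apply: le_lt_trans (P1_moment1 m); apply: ge0_le_integral => //=.
- by apply: (measurableT_comp (@measurable_normr_EFin R)).
- exact: measurable_normr_EFin.
- by move=> x _; rewrite lee_fin.
Qed.

Definition P1_push : P1 R := MkP1 push_moment1.

Lemma P1_pushE A : P1_push A = m (T @^-1` A).
Proof. by []. Qed.

Lemma integral_P1_push (f : measurableTypeR R -> \bar R) :
  measurable_fun setT f -> m.-integrable setT (f \o T) ->
  (\int[P1_push]_x f x = \int[m]_x f (T x))%E.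
Proof. by move=> mf fT; rewrite integral_distribution. Qed.

End P1_push.

(* Elements of [P1 R] are set functions on all sets, so two of them can agree on
   the measurable sets without being equal; they are then at [W1] distance 0. *)
Definition P1_eqm (R : realType) (m n : P1 R) := forall A, measurable A -> m A = n A.

Section P1_topology.
Context {R : realType}.
Implicit Types m n : P1 R.

Lemma W1_eqm m n : P1_eqm m n -> (W1 m n <= 0)%E.
Proof.
move=> mn.
(* Both measures are mixtures with weight 0 of [m] with itself, so every term of the bound
   vanishes. *)
have := @W1_mixture_le R id id (@measurable_id _ _ _) (@measurable_id _ _ _)
  (fun=> lexx _) (fun=> lexx _) m m m n 0 0.
rewrite lexx ler01 => /(_ isT isT) h; apply: le_trans (h _ _) _.
- by move=> A mA; rewrite subr0 mul1e mul0e adde0.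
- by move=> A mA; rewrite subr0 mul1e mul0e adde0 mn.
- by rewrite subrr normr0 mul0e adde0 integral0_eq ?adde0// => x _; rewrite subrr normr0.
Qed.

(** Read off from the definition of the open sets, this reduces convergence in [P1 R] to explicit
    upper bounds on [W1]. *)
Lemma nbhs_P1 m (A : set (P1 R)) : nbhs m A ->
  exists2 e : R, 0 < e & [set n | (W1 m n < e%:E)%E] `<=` A.
Proof.
move=> [B [oB Bm BA]]; have [e e0 eB] := oB _ Bm.
by exists e => // n /eB/BA.
Qed.

(** Measures at [W1] distance 0 lie in the same neighbourhoods, and real limits are separated.
    Identities between mixtures, valid on measurable sets, thus carry over to [F] and to
    [H ^~ x]. *)
Lemma continuous_eqm (f : P1 R -> R) m n : continuous f -> P1_eqm m n -> f m = f n.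
Proof.
move=> cf mn; apply/eqP; rewrite -subr_eq0 -normr_le0; apply/ler_addgt0Pr => e e0.
have /cvgrPdist_lt/(_ e e0)/nbhs_P1[d d0 dA] := cf m.
rewrite add0r; apply/ltW/dA => /=; apply: le_lt_trans (W1_eqm mn) _.
by rewrite lte_fin.
Qed.

Lemma eqm_integral m n (f : measurableTypeR R -> \bar R) : P1_eqm m n ->
  (\int[m]_x f x = \int[n]_x f x)%E.
Proof. by move=> mn; apply: eq_measure_integral => A mA _; exact: mn. Qed.

End P1_topology.

(** * Finite-range approximation and compactness *)

Lemma compact_cvg_family (X Y : topologicalType) (D : set X) (f : nat -> X -> Y)
    (g : X -> Y) :
  compact D -> (forall n, compact (f n @` D)) ->
  (forall x A, D x -> nbhs (g x) A ->
    \forall x' \near x & n \near \oo, D x' -> A (f n x') /\ A (g x')) ->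
  compact (g @` D `|` \bigcup_n (f n @` D)).
Proof.
move=> cD cf fg; apply/compact_near_coveringP => I F P FF cov.
(* Compactness of [D], applied with the index [n] added to the covering filter, gives one rank for
   all points of [D]. *)
have tail : \forall p \near filter_prod F \oo,
    D `<=` [set x | P p.1 (f p.2 x) /\ P p.1 (g x)].
  apply: (iffRL (near_covering_withinP D) (iffLR (compact_near_coveringP D) cD)
    (I * nat)%type _ (fun p x => P p.1 (f p.2 x) /\ P p.1 (g x))) => x Dx.
  have [[/= A B] [gA FB] AB] := cov (g x) (or_introl (imageP g Dx)).
  have [[/= U V] [xU V_oo] UV] := fg x A Dx gA.
  exists (U, B `*` V); first by split => //; exists (B, V).
  move=> [x' [i n]] [/= Ux' [Bi Vn]] Dx'.
  have [Af Ag] := UV (x', n) (conj Ux' Vn) Dx'.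
  by split; [exact: (AB (f n x', i))|exact: (AB (g x', i))].
have [[/= B V] [FB [N _ NV]] BV] := tail.
(* The finitely many images before that rank are treated one by one. *)
have head (k : nat) : \forall i \near F, forall n, (n < k)%N -> f n @` D `<=` P i.
  elim: k => [|k IH]; first by apply: filterE.
  have : \forall i \near F, f k @` D `<=` P i.
    apply: (iffLR (compact_near_coveringP _) (cf k)) => y Dy.
    by apply: cov; right; exists k.
  apply: filterS2 IH => i IHi Pk n; rewrite ltnS leq_eqVlt => /orP[/eqP ->//|]; exact: IHi.
apply: filterS2 FB (head N) => i Bi headi y [[x Dx <-]|[n _ [x Dx <-]]].
  by have [] := BV (i, N) (conj Bi (NV _ (leqnn N))) _ Dx.
have [nN|Nn] := ltnP n N; first by apply: (headi n nN); exists x.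
by have [] := BV (i, n) (conj Bi (NV _ Nn)) _ Dx.
Qed.

Section simple_approximation.
Import HBNNSimple.

(** Approximate the positive and negative parts of [x] from below by simple functions and subtract.
    At each point one of the two parts is zero, which gives the bound by [|x|]. *)
Lemma simple_approximation_id (R : realType) :
  exists T : nat -> measurableTypeR R -> measurableTypeR R,
  [/\ forall n, measurable_fun setT (T n), forall n x, `|T n x| <= `|x|,
      forall n, finite_set (range (T n)) & forall x, T ^~ x @ \oo --> x].
Proof.
have mp : measurable_fun [set: measurableTypeR R] (fun x => (Num.max x 0)%:E : \bar R).
  by apply/measurable_EFinP; exact: measurable_maxr.
have mn : measurable_fun [set: measurableTypeR R] (fun x => (Num.max (- x) 0)%:E : \bar R).
  by apply/measurable_EFinP; exact: measurable_maxr.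
have maxp (y : R) : 0 <= y -> Num.max y 0 = y by move/max_idPl.
have maxn (y : R) : y <= 0 -> Num.max y 0 = 0 by move/max_idPr.
pose p := nnsfun_approx measurableT mp; pose q := nnsfun_approx measurableT mn.
have p0 n (x : R) : 0 <= p n x <= Num.max x 0.
  apply/andP; split; first exact: fun_ge0.
  by rewrite -lee_fin /p nnsfun_approxE; apply: le_approx => // y _;
    rewrite lee_fin le_max lexx orbT.
have q0 n (x : R) : 0 <= q n x <= Num.max (- x) 0.
  apply/andP; split; first exact: fun_ge0.
  by rewrite -lee_fin /q nnsfun_approxE; apply: le_approx => // y _;
    rewrite lee_fin le_max lexx orbT.
exists (fun n x => p n x - q n x); split.
- by move=> n; exact: measurable_funB.
- move=> n x; have /andP[] := p0 n x; have /andP[] := q0 n x.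
  case/orP: (le_total 0 (x : R)) => x0.
    rewrite (maxp _ x0) (maxn (- x)) ?oppr_le0// => qa qb pa pb.
    by rewrite !ger0_norm; lra.
  rewrite (maxn _ x0) (maxp (- x)) ?oppr_ge0// => qa qb pa pb.
  by rewrite !ler0_norm; lra.
- move=> n; apply: (@sub_finite_set _ _ [set u - v | u in range (p n) & v in range (q n)]).
    by move=> _ [x _ <-]; exists (p n x); [exists x|exists (q n x); [exists x|]].
  by apply: finite_image2; exact: fimfunP.
- move=> x; rewrite [X in _ --> X](_ : x = Num.max x 0 - Num.max (- x) 0); last first.
    by case/orP: (le_total 0 (x : R)) => x0;
      [rewrite (maxp x) ?(maxn (- x)) ?oppr_le0 ?subr0
      |rewrite (maxn x) ?(maxp (- x)) ?oppr_ge0 ?sub0r ?opprK].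
  have max0 (y : R) : (0 <= (Num.max y 0)%:E)%E by rewrite lee_fin le_max lexx orbT.
  apply: cvgB.
    by have /fine_cvgP[_] := cvg_nnsfun_approx measurableT mp (fun y _ => max0 y) (I : setT x).
  by have /fine_cvgP[_] := cvg_nnsfun_approx measurableT mn
    (fun y _ => max0 (- y)) (I : setT x).
Qed.

End simple_approximation.

Section approximation_by_push.
Context {R : realType} (T : nat -> measurableTypeR R -> measurableTypeR R).
Hypotheses (mT : forall n, measurable_fun setT (T n)) (T_le : forall n x, `|T n x| <= `|x|).
Hypothesis T_cvg : forall x, T ^~ x @ \oo --> x.
Implicit Types m : P1 R.

(** Dominated convergence with bound [2 |x|]. The integral is the cost of transporting [m] to its
    push-forward along [x |-> T n x]. *)
Lemma cvg_integral_push_dist m :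
  (\int[m]_x `|x - T n x|%:E @[n --> \oo] --> 0)%E.
Proof.
have int2 : m.-integrable setT (fun x => (2%:E * `|x|%:E)%E).
  exact: (integrableZl measurableT 2 (integrable_normr m)).
have mB n : measurable_fun [set: measurableTypeR R] (fun x => `|x - T n x|%:E : \bar R).
  apply/measurable_EFinP/measurableT_comp => //; apply: measurable_funB;
    [exact: measurable_id|exact: mT].
have [] := @dominated_convergence _ _ _ m setT measurableT
  (fun n x => `|x - T n x|%:E) (cst 0%E) (fun x => (2%:E * `|x|%:E)%E) mB _ _ int2 _.
- exact: measurable_cst.
- apply: aeW => x _; apply: cvg_EFin; first exact: nearW.
  have : T n x - x @[n --> \oo] --> x - x by apply: cvgB => //; exact: cvg_cst.
  rewrite subrr => /cvg_norm; rewrite normr0.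
  by apply: cvg_trans; apply: near_eq_cvg; apply: nearW => n /=; rewrite distrC.
- apply: aeW => x n _; rewrite -EFinM abse_EFin lee_fin normr_id.
  by apply: (le_trans (ler_normB _ _)); have := T_le n x; lra.
by move=> _ _; rewrite integral0_eq.
Qed.

Definition mix_push (n : nat) (t : R) (m0 m : P1 R) : P1 R :=
  mix t (P1_push (mT n) (T_le n) m0) (P1_push (mT n) (T_le n) m).

Lemma W1_mix_push n t t' (m0 m : P1 R) : 0 <= t <= 1 -> 0 <= t' <= 1 ->
  (W1 (mix t m0 m) (mix_push n t' m0 m) <=
   (\int[m0]_x `|x - T n x|%:E + \int[m]_x `|x - T n x|%:E)
    + `|t' - t|%:E * (\int[m0]_x `|x|%:E + \int[m]_x `|x|%:E))%E.
Proof.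
move=> t01 t'01.
apply: (@W1_mixture_le _ id (T n) (@measurable_id _ _ _) (mT n) (fun=> lexx _) (T_le n)) => //.
- by move=> A mA; rewrite mixE.
- by move=> A mA; rewrite mixE.
Qed.

Lemma W1_mix t t' (m0 m : P1 R) : 0 <= t <= 1 -> 0 <= t' <= 1 ->
  (W1 (mix t m0 m) (mix t' m0 m) <=
   `|t' - t|%:E * (\int[m0]_x `|x|%:E + \int[m]_x `|x|%:E))%E.
Proof.
move=> t01 t'01.
have := @W1_mixture_le _ id id (@measurable_id _ _ _) (@measurable_id _ _ _)
  (fun=> lexx _) (fun=> lexx _) m0 m (mix t m0 m) (mix t' m0 m) t t' t01 t'01.
have z (n : P1 R) : (\int[n]_x `|id x - id x|%:E = 0)%E.
  by rewrite integral0_eq// => x _; rewrite subrr normr0.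
rewrite !z !add0e; apply => A mA; exact: mixE.
Qed.

Lemma fin_num_moment1 m : (\int[m]_x `|x|%:E)%E \is a fin_num.
Proof. by rewrite ge0_fin_numE ?P1_moment1//; apply: integral_ge0 => x _; rewrite lee_fin. Qed.

Lemma near_mix t (m0 m : P1 R) (A : set (P1 R)) : 0 <= t <= 1 -> nbhs (mix t m0 m) A ->
  \forall t' \near t, 0 <= t' <= 1 -> A (mix t' m0 m).
Proof.
move=> t01 /nbhs_P1[e e0 eA].
set M := (\int[m0]_x `|x|%:E + \int[m]_x `|x|%:E)%E.
have M0 : (0 <= M)%E by apply: adde_ge0; apply: integral_ge0 => x _; rewrite lee_fin.
have Mfin : M \is a fin_num by rewrite fin_numD !fin_num_moment1.
have fM0 : 0 <= fine M by exact: fine_ge0.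
(* Adding 1 keeps the denominator positive when both first moments vanish. *)
have d0 : 0 < e / (fine M + 1) by rewrite divr_gt0//; lra.
have : \forall t' \near t, `|t - t'| < e / (fine M + 1).
  exact: (@cvgr_dist_lt _ _ _ _ (nbhs_filter t) id t (@cvg_id _ _)).
apply: filterS => t' tt' t'01; apply: eA => /=.
apply: (le_lt_trans (W1_mix m0 m t01 t'01)); rewrite -/M -(fineK Mfin) -EFinM lte_fin.
move: tt'; rewrite distrC ltr_pdivlMr; last lra.
apply: le_lt_trans; apply: ler_wpM2l => //; lra.
Qed.

(** Half of the radius pays for the transport along [T n], the other half for the change of weight.
    Nearness is joint in [t'] and [n], as [compact_cvg_family] requires. *)
Lemma near_mix_push t (m0 m : P1 R) (A : set (P1 R)) : 0 <= t <= 1 -> nbhs (mix t m0 m) A ->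
  \forall t' \near t & n \near \oo, 0 <= t' <= 1 -> A (mix_push n t' m0 m).
Proof.
move=> t01 /nbhs_P1[e e0 eA].
set M := (\int[m0]_x `|x|%:E + \int[m]_x `|x|%:E)%E.
have M0 : (0 <= M)%E by apply: adde_ge0; apply: integral_ge0 => x _; rewrite lee_fin.
have Mfin : M \is a fin_num by rewrite fin_numD !fin_num_moment1.
have fM0 : 0 <= fine M by exact: fine_ge0.
have d0 : 0 < (e / 2) / (fine M + 1) by rewrite divr_gt0//; lra.
have near_t : \forall t' \near t, `|t - t'| < (e / 2) / (fine M + 1).
  exact: (@cvgr_dist_lt _ _ _ _ (nbhs_filter t) id t (@cvg_id _ _)).
have : ((\int[m0]_x `|x - T n x|%:E + \int[m]_x `|x - T n x|%:E)
    @[n --> \oo] --> 0)%E.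
  rewrite -[X in _ --> X]adde0; apply: cvgeD => //; exact: cvg_integral_push_dist.
have e2 : ((0 : \bar R) < (e / 2)%:E)%E by rewrite lte_fin; lra.
move=> /(_ [set y | (y < (e / 2)%:E)%E]) /(_ (lt_nbhsl e2)) near_n.
near=> t' n => t'01; apply: eA => /=.
apply: (le_lt_trans (W1_mix_push n m0 m t01 t'01)).
rewrite (splitr e) EFinD; apply: lteD; first by near: n.
rewrite -/M -(fineK Mfin) -EFinM lte_fin.
have : `|t - t'| < (e / 2) / (fine M + 1) by near: t'.
rewrite distrC ltr_pdivlMr; last lra.
apply: le_lt_trans; apply: ler_wpM2l => //; lra.
Unshelve. all: by end_near. Qed.

End approximation_by_push.

Lemma continuous_borel_measurable (X Y : ptopologicalType) (R : realType)
    (f : X * Y -> R) :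
  continuous f ->
  measurable_fun [set: g_sigma_algebraType (@open (X * Y)%type)] (f : _ -> measurableTypeR R).
Proof.
move=> /continuousP cf.
apply: (measurability _ (RGenOpens.measurableE R)) => _ [_ [a [b ->] <-]].
rewrite setTI; apply: sub_sigma_algebra; apply: cf; exact: interval_open.
Qed.

Section compact_mixtures.
Context {R : realType}.

Lemma within_continuous_mix (m0 m : P1 R) :
  {within `[0, 1], continuous (fun t => mix t m0 m)}.
Proof.
apply/subspace_continuousP => t; rewrite /= in_itv /= => t01 A.
move=> /(near_mix t01); apply: filterS => t' h t'01; exact: h.
Qed.

Lemma compact_mix (m0 m : P1 R) : compact ((fun t => mix t m0 m) @` `[0, 1]).
Proof.
apply: continuous_compact; last exact: segment_compact.
exact: within_continuous_mix.
Qed.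

(** Sublinearity of [H] on this single compact set gives a growth constant valid for all weights and
    all approximants. *)
Lemma compact_mix_push (T : nat -> measurableTypeR R -> measurableTypeR R)
    (mT : forall n, measurable_fun setT (T n)) (T_le : forall n x, `|T n x| <= `|x|)
    (T_cvg : forall x, T ^~ x @ \oo --> x) (m0 m : P1 R) :
  compact ((fun t => mix t m0 m) @` `[0, 1] `|`
           \bigcup_n ((fun t => mix_push mT T_le n t m0 m) @` `[0, 1])).
Proof.
apply: compact_cvg_family; first exact: segment_compact.
- by move=> n; exact: compact_mix.
- move=> t A; rewrite /= in_itv /= => t01 mA.
  have [[/= U V] [tU V_oo] UV] := near_mix_push mT T_le T_cvg t01 mA.
  exists (U `&` [set t' | 0 <= t' <= 1 -> A (mix t' m0 m)], V).
    by split => //; apply: filterI => //; exact: near_mix.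
  move=> [t' n] [/= [Ut' At'] Vn]; rewrite in_itv /= => t'01.
  by split; [exact: (UV (t', n))|exact: At'].
Qed.

End compact_mixtures.

(** * Regularity and integrability of functions of class C^{0,1} *)

Section C01.
Context {R : realType} (H : P1 R -> R -> R).
Hypothesis H_C01 : class_C01 H.

Lemma C01_continuous_r (m : P1 R) : continuous (H m).
Proof.
have [H1 _ _ _] := H_C01; move=> x.
by apply/differentiable_continuous/derivable1_diffP; have [] := H1 m.
Qed.

(* On a neighbourhood where the x-derivative is bounded, the mean value theorem
   controls the variation in x uniformly in m. *)
Lemma C01_continuous : continuous (fun p : P1 R * R => H p.1 p.2).
Proof.
have [H1 H2 _ H4] := H_C01; move=> [m x] /=.
apply/cvgrPdist_lt => e e0.
(* Joint continuity of the x-derivative with tolerance 1 makes [C] a bound for it near [(m, x)]. *)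
pose C := `|derive1 (H m) x| + 1.
have C0 : 0 < C by rewrite ltr_wpDl.
have /cvgrPdist_lt/(_ 1 ltr01) [[/= U V] [mU xV] UV] := H4 (m, x).
have /nbhs_ballP[r /= r0 rV] := xV.
have /cvgrPdist_lt/(_ (e / 2)) He := H2 x m.
have e2 : 0 < e / 2 by rewrite divr_gt0.
(* Radius [r] keeps the segment from [x] to [x'] where the derivative is bounded; [e / 2 / C] limits
   the variation in x to [e / 2]. The other half of [e] is for the variation in [m] at fixed [x]. *)
have d0 : 0 < Num.min r (e / 2 / C) by rewrite lt_min r0 divr_gt0.
exists (U `&` [set m' | `|H m x - H m' x| < e / 2], ball x (Num.min r (e / 2 / C))).
  split => /=; first by apply: filterI => //; exact: He.
  exact: nbhsx_ballx.
move=> [m' x'] /= [[Um' Hm'] xx'].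
have {}xx' : `|x - x'| < Num.min r (e / 2 / C) by [].
have /andP[xr xe] : (`|x - x'| < r) && (`|x - x'| < e / 2 / C) by rewrite -lt_min.
have bound (y : R) : `|x - y| < r -> `|derive1 (H m') y| < C.
  move=> xy; have /= := UV (m', y) (conj Um' (rV _ xy)).
  rewrite /C => h; have := ler_distD (derive1 (H m) x) (derive1 (H m') y) 0.
  rewrite !subr0 distrC => h'; apply: (le_lt_trans h'); rewrite addrC ltrD2l //.
have dH (y : R) : is_derive y 1 (H m') (derive1 (H m') y).
  by apply: DeriveDef; [have [] := H1 m'|rewrite derive1E].
have key (a b : R) : a <= b -> `|x - a| < r -> `|x - b| < r -> `|b - a| < e / 2 / C ->
    `|H m' b - H m' a| < e / 2.
  move=> ab xa xb ba.
  have [c] := MVT_segment ab (fun y _ => dH y)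
    (continuous_subspaceT (@C01_continuous_r m')).
  rewrite in_itv /= => /andP[ac cb] ->; rewrite normrM.
  have xc : `|x - c| < r.
    by move: xa xb; rewrite !ltr_norml => /andP[? ?] /andP[? ?]; apply/andP; split; lra.
  apply: (@le_lt_trans _ _ (C * `|b - a|)).
    by apply: ler_wpM2r => //; exact/ltW/bound.
  by rewrite mulrC -ltr_pdivlMr.
have xx : `|x - x| < r by rewrite subrr normr0.
have H' : `|H m' x - H m' x'| < e / 2.
  have [le|/ltW le] := leP x' x; first exact: key.
  by rewrite distrC; apply: key => //; rewrite distrC.
rewrite (splitr e); apply: le_lt_trans (ltrD Hm' H'); exact: ler_distD.
Qed.

Lemma C01_measurable_r (m : P1 R) : measurable_fun [set: measurableTypeR R] (H m).
Proof. by apply: continuous_measurable_fun; exact: C01_continuous_r. Qed.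

(** A singleton is compact, so [H m] grows at most linearly, and [n] has a finite first moment. *)
Lemma C01_integrable (m n : P1 R) : n.-integrable setT (EFin \o H m).
Proof.
have [_ _ H3 _] := H_C01.
have [C C0 HC] := H3 [set m] (@compact_set1 (P1 R) m).
have ig : n.-integrable setT (fun x => C%:E * (cst 1 x + `|x|%:E))%E.
  apply: integrableZl => //; apply: integrableD => //; last exact: integrable_normr.
  exact: finite_measure_integrable_cst.
apply: le_integrable ig => //; first by apply/measurable_EFinP; exact: C01_measurable_r.
move=> x _ /=; rewrite lee_fin [leRHS]ger0_norm; first exact: HC.
by rewrite mulr_ge0 ?addr_ge0// ltW.
Qed.

End C01.

(** * Finitely supported measures *)

Section mix_integral.
Context {R : realType} (t : R) (m n : P1 R).
Hypothesis t01 : 0 <= t <= 1.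
Local Open Scope ereal_scope.

Lemma ge0_integral_mix (f : measurableTypeR R -> \bar R) :
  measurable_fun setT f -> (forall x, 0 <= f x) ->
  \int[mix t m n]_x f x = (1 - t)%:E * \int[m]_x f x + t%:E * \int[n]_x f x.
Proof.
move=> mf f0; rewrite /= /mix_measure ge0_integral_measure_add//.
rewrite !ge0_integral_mscale//= /clamp01.
by have /andP[t0 t1] := t01; rewrite (min_idPr t1) (max_idPr t0).
Qed.

Lemma integral_mix (f : measurableTypeR R -> \bar R) :
  m.-integrable setT f -> n.-integrable setT f ->
  \int[mix t m n]_x f x = (1 - t)%:E * \int[m]_x f x + t%:E * \int[n]_x f x.
Proof.
move=> mf nf; have mmf := measurable_int _ mf.
rewrite [LHS]integralE [\int[m]_x f x]integralE [\int[n]_x f x]integralE.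
rewrite !ge0_integral_mix//; [|exact: measurable_funeneg|exact: measurable_funepos].
have fin_pos (p : P1 R) : p.-integrable setT f -> \int[p]_x f^\+ x \is a fin_num.
  by move=> pf; apply: integral_fune_fin_num => //; exact: integrable_funepos.
have fin_neg (p : P1 R) : p.-integrable setT f -> \int[p]_x f^\- x \is a fin_num.
  by move=> pf; apply: integral_fune_fin_num => //; exact: integrable_funeneg.
rewrite -(fineK (fin_pos _ mf)) -(fineK (fin_pos _ nf)).
rewrite -(fineK (fin_neg _ mf)) -(fineK (fin_neg _ nf)).
by rewrite -!(EFinM, EFinD, EFinN, EFinB); congr (_%:E); ring.
Qed.

End mix_integral.

Section eqm_mix.
Context {R : realType}.
Implicit Types (m n p : P1 R) (t : R).

Lemma P1_fin m A : measurable A -> m A \is a fin_num.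
Proof. by move=> mA; exact: fin_num_measure. Qed.

Lemma fine_mix m n t A : 0 <= t <= 1 -> measurable A ->
  mix t m n A = ((1 - t) * fine (m A) + t * fine (n A))%:E.
Proof. by move=> t01 mA; rewrite [RHS]EFinD ![in RHS]EFinM !fineK ?P1_fin// mixE. Qed.

Lemma eqm_mix0 m n : P1_eqm (mix 0 m n) m.
Proof.
by move=> A mA; rewrite fine_mix ?lexx ?ler01// subr0 mul1r mul0r addr0 fineK// P1_fin.
Qed.

Lemma eqm_mix1 m n : P1_eqm (mix 1 m n) n.
Proof.
by move=> A mA; rewrite fine_mix ?lexx ?ler01// subrr mul1r mul0r add0r fineK// P1_fin.
Qed.

Lemma eqm_mixr t m n p : 0 <= t <= 1 -> P1_eqm n p -> P1_eqm (mix t m n) (mix t m p).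
Proof. by move=> t01 np A mA; rewrite !fine_mix// np. Qed.

Lemma eqm_trans m n p : P1_eqm m n -> P1_eqm n p -> P1_eqm m p.
Proof. by move=> mn np A mA; rewrite mn// np. Qed.

(** Mixing [mix a n p] into [m] can be done in two stages, first [n] with weight [s], then [p] with
    weight [e * a]. The equation says that the mass of [n] left after the second stage is right. *)
Lemma eqm_mix_mix e a s m n p : 0 <= e <= 1 -> 0 <= a <= 1 -> 0 <= s <= 1 ->
  (1 - e * a) * s = e * (1 - a) ->
  P1_eqm (mix e m (mix a n p)) (mix (e * a) (mix s m n) p).
Proof.
move=> /andP[e0 e1] /andP[a0 a1] /andP[s0 s1] es A mA.
have ea : 0 <= e * a <= 1 by rewrite mulr_ge0//= -[leRHS]mulr1 ler_pM.
rewrite !fine_mix ?e0 ?a0 ?s0//=; congr (_%:E).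
set M := fine (m A); set N := fine (n A); set P := fine (p A).
have -> : (1 - e * a) * ((1 - s) * M + s * N) + e * a * P =
  (1 - e * a) * M + ((1 - e * a) * s) * (N - M) + e * a * P by ring.
by rewrite es; ring.
Qed.

(** Going forward from [t] to [u] on the segment means mixing in the endpoint [n] with relative
    weight [(u - t) / (1 - t)]. Going backward, in [eqm_mixEl], mixes in [m] with relative weight
    [(t - u) / t]. *)
Lemma eqm_mixE t u e m n : 0 <= t <= 1 -> 0 <= u <= 1 -> 0 <= e <= 1 ->
  u - t = e * (1 - t) -> P1_eqm (mix u m n) (mix e (mix t m n) n).
Proof.
move=> t01 u01 e01 ute A mA; rewrite !fine_mix//=; congr (_%:E).
have -> : u = t + e * (1 - t) by rewrite -ute; ring.
by ring.
Qed.

Lemma eqm_mixEl t u e m n : 0 <= t <= 1 -> 0 <= u <= 1 -> 0 <= e <= 1 ->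
  t - u = e * t -> P1_eqm (mix u m n) (mix e (mix t m n) m).
Proof.
move=> t01 u01 e01 ute A mA; rewrite !fine_mix//=; congr (_%:E).
have -> : u = t - e * t by rewrite -ute; ring.
by ring.
Qed.

End eqm_mix.

Section finitely_supported.
Context {R : realType} (K : R).

(** Built up by adding one atom at a time, so that induction reduces a direction [nu] to Dirac
    directions. Stated up to [P1_eqm], since mixtures are identified only on measurable sets. *)
Inductive fin_supported : P1 R -> Prop :=
| fin_supported_dirac (nu : P1 R) x : - K <= x <= K -> P1_eqm nu (P1_dirac x) ->
    fin_supported nu
| fin_supported_mix (nu nu' : P1 R) a x : 0 < a < 1 -> - K <= x <= K ->
    fin_supported nu' -> P1_eqm nu (mix a nu' (P1_dirac x)) -> fin_supported nu.

Lemma measurable_support : measurable (~` `[- K, K]%classic : set (measurableTypeR R)).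
Proof. by apply: measurableC; exact: measurable_itv. Qed.

Lemma P1_supported_eqm (m n : P1 R) : P1_eqm m n -> P1_supported K n -> P1_supported K m.
Proof. by move=> mn; rewrite /P1_supported /= mn//; exact: measurable_support. Qed.

Lemma P1_supported_dirac x : - K <= x <= K -> P1_supported K (P1_dirac x).
Proof.
move=> xK; rewrite /P1_supported /= diracE memNset//= => /(_ _); apply.
Qed.

Lemma P1_supported_mix t (m n : P1 R) : 0 <= t <= 1 ->
  P1_supported K m -> P1_supported K n -> P1_supported K (mix t m n).
Proof.
move=> t01; rewrite /P1_supported /= => mK nK.
have := mixE m n (~` `[- K, K]%classic) t01; rewrite mK nK !mule0 adde0; exact.
Qed.

Lemma fin_supported_P1_supported nu : fin_supported nu -> P1_supported K nu.
Proof.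
elim=> {nu} [nu x xK nux|nu nu' a x /andP[a0 a1] xK _ IH nuE].
  by apply: P1_supported_eqm nux _; exact: P1_supported_dirac.
apply: P1_supported_eqm nuE _; apply: P1_supported_mix => //; last exact: P1_supported_dirac.
by rewrite !ltW.
Qed.

End finitely_supported.

(** * Derivatives along segments between finitely supported measures *)

Section dawson.
Context {R : realType} (F : P1 R -> R) (H : P1 R -> R -> R) (K : R).
Hypotheses (F_cont : continuous F) (H_C01 : class_C01 H).
Hypothesis F_dawson : uniformly_dawson_differentiable K F H.
Hypothesis H_centered : forall m : P1 R, P1_supported K m -> (\int[m]_x (H m x)%:E = 0)%E.

Let J (m n : P1 R) : R := fine (\int[n]_x (H m x)%:E)%E.

Lemma EFin_integral_C01 (m n : P1 R) : (J m n)%:E = (\int[n]_x (H m x)%:E)%E.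
Proof. by rewrite fineK//; apply: integrable_fin_num => //; exact: C01_integrable. Qed.

Let J_mix (m n p : P1 R) t : 0 <= t <= 1 ->
  J m (mix t n p) = (1 - t) * J m n + t * J m p.
Proof.
move=> t01; apply: EFin_inj; rewrite EFinD !EFinM !EFin_integral_C01.
by apply: integral_mix => //; exact: C01_integrable.
Qed.

Let J_eqm (m n p : P1 R) : P1_eqm n p -> J m n = J m p.
Proof. by move=> np; rewrite /J (eqm_integral _ np). Qed.

Let J_dirac (m : P1 R) x : J m (P1_dirac x) = H m x.
Proof.
apply: EFin_inj; rewrite EFin_integral_C01 integral_dirac//.
  by rewrite diracT mul1e.
by apply/measurable_EFinP; exact: C01_measurable_r.
Qed.

(** For such [nu] the integral is a finite convex combination of values [H m x], each continuous in
    [m]. *)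
Let J_continuous nu : fin_supported K nu -> continuous (fun m => J m nu).
Proof.
have [_ H2 _ _] := H_C01.
elim=> {nu} [nu x _ nux|nu nu' a x /andP[a0 a1] _ _ IH nuE] m.
  rewrite (_ : (fun m => J m nu) = fun m => H m x); first exact: H2.
  by apply/funext => p; rewrite (J_eqm _ nux) J_dirac.
rewrite (_ : (fun m => J m nu) = fun m => (1 - a) * J m nu' + a * H m x).
  have c1 : (1 - a) * J p nu' @[p --> m] --> (1 - a) * J m nu'.
    exact: (cvgM (cvg_cst (1 - a)) (IH m)).
  have c2 : a * H p x @[p --> m] --> a * H m x.
    exact: (cvgM (cvg_cst a) (H2 x m)).
  exact: cvgD c1 c2.
by apply/funext => p; rewrite (J_eqm _ nuE) J_mix ?J_dirac// !ltW.
Qed.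

(** The Dawson quotient multiplied by [e]. The supremum in the hypothesis makes [d] independent of
    [m] and [x]. *)
Let dawson_bound (eta : R) : 0 < eta -> exists2 d, 0 < d &
  forall e m x, 0 < e < d -> P1_supported K m -> - K <= x <= K ->
  `|F (mix e m (P1_dirac x)) - F m - e * H m x| <= eta * e.
Proof.
move=> eta0; have eta0' : ((0 : \bar R) < eta%:E)%E by rewrite lte_fin.
have := F_dawson; move=> /(_ [set y | (y < eta%:E)%E]) /(_ (lt_nbhsl eta0')).
move=> /nbhs_ballP[d /= d0 dP]; exists d => // e m x /andP[e0 ed] mK xK.
have ed_ball : ball 0 d e by rewrite /ball/= sub0r normrN gtr0_norm.
have sup_lt := dP e ed_ball e0.
have : (`|e^-1 * (F (mix e m (P1_dirac x)) - F m) - H m x|%:E < eta%:E)%E.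
  apply: le_lt_trans sup_lt; by apply: ereal_sup_ubound; exists (m, x).
rewrite lte_fin => /ltW h.
have -> : F (mix e m (P1_dirac x)) - F m - e * H m x =
   (e^-1 * (F (mix e m (P1_dirac x)) - F m) - H m x) * e.
  by field; rewrite gt_eqF.
by rewrite normrM (gtr0_norm e0); apply: ler_wpM2r => //; exact: ltW.
Qed.

(* The atoms of [nu] are mixed in one at a time.  All but the last one displace
   the base point by O(e), so Dawson differentiability has to be uniform in the
   base point. *)
Lemma derivative_fin_supported nu : fin_supported K nu ->
  forall m, P1_supported K m -> forall eta : R, 0 < eta -> exists2 d, 0 < d &
  forall e, 0 < e < d -> e <= 1 -> `|F (mix e m nu) - F m - e * J m nu| <= eta * e.
Proof.
elim=> {nu} [nu x xK nux|nu nu' a x /andP[a0 a1] xK nu'K IH nuE] m mK eta eta0.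
  have [d d0 dP] := dawson_bound eta0.
  exists d => // e ed e1; have /andP[e0 _] := ed.
  have e01 : 0 <= e <= 1 by rewrite ltW.
  rewrite (continuous_eqm F_cont (eqm_mixr m e01 nux)) (J_eqm _ nux) J_dirac.
  exact: dP.
have eta4 : 0 < eta / 4 by lra.
have [d1 d10 IHd] := IH m mK _ eta4.
have [d2 d20 dawson] := dawson_bound eta4.
have [_ H2 _ _] := H_C01.
(* The continuity used next is at [mix 0 m nu'], which agrees with [m] on measurable sets. *)
have H0 : H (mix 0 m nu') x = H m x.
  by apply: (continuous_eqm (H2 x)); exact: eqm_mix0.
have [d3 /= d30 H3] : exists2 d3, 0 < d3 & forall s, 0 <= s <= 1 -> s < d3 ->
    `|H m x - H (mix s m nu') x| < eta / 4.
  have /cvgrPdist_lt/(_ _ eta4) := H2 x (mix 0 m nu').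
  move=> /(@near_mix R 0); rewrite lexx ler01 => /(_ isT) /nbhs_ballP[r /= r0 rP].
  exists r => // s s01 sr; rewrite -H0; apply: rP => //=.
  by rewrite /ball/= sub0r normrN ger0_norm//; case/andP: s01.
set j := J m nu'; set d4 := eta / 4 / (`|j| + 1).
have j0 : 0 < `|j| + 1 by rewrite ltr_wpDl.
have d40 : 0 < d4 by rewrite divr_gt0.
(* The four bounds serve the induction hypothesis, the Dawson estimate, the continuity of [H ^~ x]
   at [m], and the second-order term [e * a * s * j]. *)
exists (Num.min (Num.min d1 d2) (Num.min d3 d4)).
  by rewrite !lt_min d10 d20 d30 d40.
move=> e; rewrite !lt_min => /andP[e0 /andP[/andP[ed1 ed2] /andP[ed3 ed4]]] e1.
have a01 : 0 <= a <= 1 by rewrite !ltW.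
have e01 : 0 <= e <= 1 by rewrite ltW.
have ea0 : 0 < e * a by rewrite mulr_gt0.
have ea_lt : e * a < e by rewrite -[ltRHS]mulr1 ltr_pM2l.
have oea : 0 < 1 - e * a by lra.
pose s := e * (1 - a) / (1 - e * a).
have es : (1 - e * a) * s = e * (1 - a) by rewrite /s; field; rewrite gt_eqF.
have s0 : 0 < s by rewrite divr_gt0// mulr_gt0// subr_gt0.
have se : s <= e by rewrite ler_pdivrMr//; nra.
have s01 : 0 <= s <= 1 by apply/andP; split; lra.
clearbody s; set m' := mix s m nu'.
have m'K : P1_supported K m'.
  by apply: P1_supported_mix => //; exact: fin_supported_P1_supported.
have FE : F (mix e m nu) = F (mix (e * a) m' (P1_dirac x)).
  apply: (continuous_eqm F_cont); apply: eqm_trans (eqm_mixr m e01 nuE) _.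
  exact: eqm_mix_mix.
have JE : J m nu = (1 - a) * j + a * H m x by rewrite (J_eqm _ nuE) J_mix// J_dirac.
have h1 : `|F (mix (e * a) m' (P1_dirac x)) - F m' - (e * a) * H m' x| <= eta / 4 * (e * a).
  by apply: dawson => //; rewrite ea0 (lt_trans ea_lt).
have h2 : `|F m' - F m - s * j| <= eta / 4 * s.
  by apply: IHd; [rewrite s0 (le_lt_trans se)|lra].
have h3 : `|H m x - H m' x| <= eta / 4 by apply/ltW/H3 => //; exact: le_lt_trans ed3.
have h4 : e * `|j| <= eta / 4.
  have := ltW ed4; rewrite /d4 ler_pdivlMr// => h; apply: le_trans h.
  by apply: ler_wpM2l; [exact: ltW|lra].
(* Four errors, each at most [eta / 4 * e]: the Dawson estimate at the displaced point [m'], the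
   induction hypothesis for [nu'], the variation of [H] from [m] to [m'], and the excess of [s] over
   [e * (1 - a)], which is [e * a * s]. *)
have decomp : F (mix e m nu) - F m - e * J m nu =
  (F (mix (e * a) m' (P1_dirac x)) - F m' - (e * a) * H m' x) +
  (F m' - F m - s * j) - (e * a) * (H m x - H m' x) + (e * a) * s * j.
  rewrite FE JE.
  have -> : e * a * s = s - e * (1 - a) by rewrite -es; ring.
  by ring.
have bea : eta / 4 * (e * a) <= eta / 4 * e by apply: ler_wpM2l; exact: ltW.
have bs : eta / 4 * s <= eta / 4 * e by apply: ler_wpM2l => //; exact: ltW.
have b3 : `|(e * a) * (H m x - H m' x)| <= eta / 4 * e.
  rewrite normrM (gtr0_norm ea0) mulrC; apply: ler_pM => //; exact: ltW.
have b4 : `|(e * a) * s * j| <= eta / 4 * e.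
  rewrite !normrM (gtr0_norm e0) (gtr0_norm a0) (gtr0_norm s0).
  have : s * `|j| <= eta / 4 by apply: le_trans h4; exact: ler_wpM2r.
  have sj0 : 0 <= s * `|j| by rewrite mulr_ge0// ltW.
  by move=> hh; rewrite -mulrA mulrC; apply: ler_pM => //; lra.
rewrite decomp; apply: (le_trans (ler_normD _ _)).
have := ler_normB ((F (mix (e * a) m' (P1_dirac x)) - F m' - (e * a) * H m' x) +
  (F m' - F m - s * j)) ((e * a) * (H m x - H m' x)).
have := ler_normD (F (mix (e * a) m' (P1_dirac x)) - F m' - (e * a) * H m' x)
  (F m' - F m - s * j).
lra.
Qed.

Section ftc.
Variables m0 m : P1 R.
Hypotheses (m0K : fin_supported K m0) (mK : fin_supported K m).

Let f (t : R) := F (mix t m0 m).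
Let g (t : R) := J (mix t m0 m) m - J (mix t m0 m) m0.

Let J_centered t : 0 <= t <= 1 ->
  (1 - t) * J (mix t m0 m) m0 + t * J (mix t m0 m) m = 0.
Proof.
move=> t01; rewrite -J_mix// /J H_centered//.
by apply: P1_supported_mix => //; exact: fin_supported_P1_supported.
Qed.

(** With [A] and [B] the integrals of [H (mix t m0 m)] against [m0] and [m], the slope is
    [B / (1 - t)] on the right and [- A / t] on the left. Centring, [(1 - t) A + t B = 0], makes
    both equal to [B - A]. *)
Let f_derivative (t : R) : 0 < t < 1 -> is_derive t 1 f (g t).
Proof.
move=> /andP[t0 t1]; have t01 : 0 <= t <= 1 by rewrite !ltW.
have mtK : P1_supported K (mix t m0 m).
  by apply: P1_supported_mix => //; exact: fin_supported_P1_supported.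
suff lim : h^-1 *: (f (h *: 1 + t) - f t) @[h --> 0^'] --> g t.
  by apply: DeriveDef; [apply/cvg_ex; exists (g t)|rewrite /derive; apply: cvg_lim].
have ot0 : 0 < 1 - t by lra.
apply/cvgrPdist_le => eta eta0.
(* The factors [1 - t] and [t] in the tolerances turn errors relative to the weight [e] into
   [eta * |h|]. *)
have [d1 d10 right] := derivative_fin_supported mK mtK (mulr_gt0 eta0 ot0).
have [d2 d20 left] := derivative_fin_supported m0K mtK (mulr_gt0 eta0 t0).
have := J_centered t01; set A := J _ m0; set B := J _ m => AB.
have gE : g t = B - A by [].
(* The first two bounds give [e < d1] or [e < d2]; the last two give [e <= 1] and keep [t + h] in
   [0, 1]. *)
pose d := Num.min (Num.min (d1 * (1 - t)) (d2 * t)) (Num.min (1 - t) t).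
have d0 : 0 < d by rewrite !lt_min ot0 t0 !mulr_gt0.
apply/nbhs_ballP; exists d => //= h; rewrite /ball /= sub0r normrN => hd hn0.
move: hd; rewrite !lt_min => /andP[/andP[hd1 hd2] /andP[hd3 hd4]].
rewrite [h *: 1]mulr1.
have scaleE : h^-1 *: (f (h + t) - f t) = h^-1 * (f (h + t) - f t) by [].
rewrite scaleE.
have -> : g t - h^-1 * (f (h + t) - f t) = - ((f (h + t) - f t - h * g t) / h).
  by field.
rewrite normrN normrM normfV ler_pdivrMr ?normr_gt0//.
have [h0|h0|h0] := ltgtP h 0; last by rewrite h0 eqxx in hn0.
- rewrite (ltr0_norm h0) in hd1 hd2 hd3 hd4 *.
  pose e := - h / t.
  have e0 : 0 < e by rewrite divr_gt0// oppr_gt0.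
  have ed : e < d2 by rewrite ltr_pdivrMr.
  have e1 : e <= 1 by rewrite ler_pdivrMr//; lra.
  have et : e * t = - h by rewrite /e; field; rewrite gt_eqF.
  have -> : f (h + t) = F (mix e (mix t m0 m) m0).
    apply: (continuous_eqm F_cont); apply: eqm_mixEl => //;
      rewrite ?et; try (apply/andP; split); lra.
  have := left e; rewrite e0 ed => /(_ isT e1).
  have -> : h * g t = e * A.
    rewrite gE; have -> : h = - (e * t) by rewrite et opprK.
    have -> : - (e * t) * (B - A) = e * A - e * ((1 - t) * A + t * B) by ring.
    by rewrite AB mulr0 subr0.
  by move=> hh; apply: (le_trans hh); rewrite -mulrA [t * e]mulrC et.
- rewrite (gtr0_norm h0) in hd1 hd2 hd3 hd4 *.
  pose e := h / (1 - t).
  have e0 : 0 < e by rewrite divr_gt0.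
  have ed : e < d1 by rewrite ltr_pdivrMr.
  have e1 : e <= 1 by rewrite ler_pdivrMr//; lra.
  have et : e * (1 - t) = h by rewrite /e; field; rewrite gt_eqF.
  have -> : f (h + t) = F (mix e (mix t m0 m) m).
    apply: (continuous_eqm F_cont); apply: eqm_mixE => //;
      rewrite ?et; try (apply/andP; split); lra.
  have := right e; rewrite e0 ed => /(_ isT e1).
  have -> : h * g t = e * B.
    rewrite gE -et.
    have -> : e * (1 - t) * (B - A) = e * B - e * ((1 - t) * A + t * B) by ring.
    by rewrite AB mulr0 subr0.
  by move=> hh; apply: (le_trans hh); rewrite -mulrA [(1 - t) * e]mulrC et.
Qed.

Let g_continuous : {within `[0, 1], continuous g}.
Proof.
have c (nu : P1 R) : fin_supported K nu ->
    {within `[0, 1], continuous (fun t => J (mix t m0 m) nu)}.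
  move=> nuK; have cm := @within_continuous_mix R m0 m.
  move=> t A At; exact: (cm t _ (J_continuous nuK At)).
by move=> t; exact: (cvgB (c m mK t) (c m0 m0K t)).
Qed.

(** The integrand for general endpoints is later measurable as a pointwise limit of these. *)
Lemma measurable_fin_supported_derivative :
  measurable_fun (`[0%R, 1%R]%classic : set (measurableTypeR R)) (fun t =>
    (\int[m]_x (H (mix t m0 m) x)%:E - \int[m0]_x (H (mix t m0 m) x)%:E)%E).
Proof.
rewrite (_ : (fun t => _) = EFin \o g).
  apply/measurable_EFinP; apply: subspace_continuous_measurable_fun => //.
by apply/funext => t; rewrite /= EFinB !EFin_integral_C01.
Qed.

Lemma fin_supported_ftc : (F m - F m0)%:E =
  (\int[lebesgue_measure]_(t in `[0%R, 1%R])
    (\int[m]_x (H (mix t m0 m) x)%:E - \int[m0]_x (H (mix t m0 m) x)%:E))%E.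
Proof.
have f1 : f 1 = F m by apply: (continuous_eqm F_cont); exact: eqm_mix1.
have f0 : f 0 = F m0 by apply: (continuous_eqm F_cont); exact: eqm_mix0.
(* Continuity of [f] is controlled inside [0, 1], which gives the one-sided limits at the
   endpoints. *)
have f_near (t : R) (A : set R) : 0 <= t <= 1 -> nbhs (f t) A ->
    \forall t' \near t, 0 <= t' <= 1 -> A (f t').
  by move=> t01 /F_cont; exact: near_mix.
have i0 : 0 <= (0 : R) <= 1 by rewrite lexx ler01.
have i1 : 0 <= (1 : R) <= 1 by rewrite lexx ler01.
rewrite -f1 -f0 EFinB -(@continuous_FTC2 _ g f 0 1 ltr01 g_continuous).
- by apply: eq_integral => t _; rewrite EFinB !EFin_integral_C01.
- split.
  + by move=> t; rewrite in_itv /= => /f_derivative [].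
  + move=> A /(f_near _ _ i0) h.
    have h' : \forall t \near (0 : R)^'+, 0 <= t <= 1 -> A (f t).
      by apply: (filterS _ h) => t ht _.
    suff : \forall t \near (0 : R)^'+, A (f t) by [].
    near=> t; have ht : 0 <= t <= 1 -> A (f t) by near: t; exact: h'.
    by apply: ht; apply/andP; split; near: t; [exact: nbhs_right_ge|exact: nbhs_right_le].
  + move=> A /(f_near _ _ i1) h.
    have h' : \forall t \near (1 : R)^'-, 0 <= t <= 1 -> A (f t).
      by apply: (filterS _ h) => t ht _.
    suff : \forall t \near (1 : R)^'-, A (f t) by [].
    near=> t; have ht : 0 <= t <= 1 -> A (f t) by near: t; exact: h'.
    by apply: ht; apply/andP; split; near: t; [exact: nbhs_left_ge|exact: nbhs_left_le].
- move=> t; rewrite in_itv /= => /f_derivative ft; rewrite derive1E; exact: derive_val.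
Unshelve. all: by end_near. Qed.

End ftc.

End dawson.

(** * Decomposition of measures carried by finite sets *)

Section conditional.
Context {R : realType} (nu : P1 R) (D : set (measurableTypeR R)).
Hypotheses (mD : measurable D) (nuD : (0 < nu D)%E).

(** The last argument of [mnormalize] is its default for zero or infinite mass; both cases are
    excluded here. *)
Let cond : probability (measurableTypeR R) R := mnormalize (mrestr nu mD) nu.

Let condE A : cond A = (nu (A `&` D) * (fine (nu D))^-1%:E)%E.
Proof.
have DT : mrestr nu mD setT = nu D by congr (nu _); exact: setTI.
have Dy : (nu D < +oo)%E by have := P1_fin nu mD; rewrite ge0_fin_numE.
change (mnormalize (mrestr nu mD) nu A = (nu (A `&` D) * (fine (nu D))^-1%:E)%E).
rewrite /mnormalize; case: ifPn => [/orP[]/eqP h|_].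
- by move: nuD; rewrite -(etrans (esym h) DT) ltxx.
- by move: Dy; rewrite -(etrans (esym h) DT) ltxx.
- by congr (_ * (fine _)^-1%:E)%E; exact: DT.
Qed.

Let cond_moment1 : (\int[cond]_x `|x|%:E < +oo)%E.
Proof.
have c0 : 0 <= (fine (nu D))^-1 by rewrite invr_ge0 fine_ge0.
rewrite (eq_measure_integral (mscale (NngNum c0) (mrestr nu mD))); last first.
  by move=> A mA _; rewrite [LHS]condE [LHS]muleC.
have mabs := @measurable_normr_EFin R.
rewrite ge0_integral_mscale//=; apply: lte_mul_pinfty; rewrite ?lee_fin//.
apply: le_lt_trans (P1_moment1 nu).
rewrite [leRHS](eq_measure_integral (measure_add (mrestr nu mD) (mrestr nu (measurableC mD)))).
  by rewrite ge0_integral_measure_add// leeDl//; apply: integral_ge0.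
move=> A mA _; apply: esym; apply: (etrans (measure_addE _ _ _)).
change (nu (A `&` D) + nu (A `&` ~` D) = nu A)%E.
by rewrite -setDE addeC; apply: esym; exact: measureDI.
Qed.

Definition P1_cond : P1 R := MkP1 cond_moment1.

Lemma P1_condE A : P1_cond A = (nu (A `&` D) * (fine (nu D))^-1%:E)%E.
Proof. exact: condE. Qed.

End conditional.

Lemma set_mem_cons (T : eqType) (x : T) (s : seq T) :
  [set` x :: s] = [set x] `|` [set` s].
Proof.
apply/seteqP; split => y /=; rewrite inE.
  by move=> /orP[/eqP|]; [left|right].
by move=> [->|ys]; [rewrite eqxx|rewrite ys orbT].
Qed.

Lemma measurable_seq_set (R : realType) (s : seq R) :
  measurable ([set` s] : set (measurableTypeR R)).
Proof.
elim: s => [|x s IH]; first by rewrite set_nil.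
by rewrite set_mem_cons; apply: measurableU => //; exact: measurable_set1.
Qed.

Lemma P1_diracE (R : realType) (x : R) (A : set R) : P1_dirac x A = ((x \in A)%:R : R)%:E.
Proof. exact: diracE. Qed.

(** Induction on the list. If the mass [a] of the head [x] lies strictly between 0 and 1, then [nu]
    is the mixture, with weight [a] on the Dirac mass at [x], of that mass and of [nu] conditioned
    on the complement of [x], which is carried by the tail. *)
Lemma fin_supported_seq (R : realType) (K : R) (s : seq R) :
  (forall x, x \in s -> - K <= x <= K) ->
  forall nu : P1 R, nu (~` [set` s]) = 0%E -> fin_supported K nu.
Proof.
elim: s => [_ nu|x s IH sK nu nus].
  by rewrite set_nil setC0 P1_setT => /eqP; rewrite onee_eq0.
have xK : - K <= x <= K by apply: sK; rewrite mem_head.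
have {}IH : forall nu : P1 R, nu (~` [set` s]) = 0%E -> fin_supported K nu.
  by apply: IH => y ys; apply: sK; rewrite inE ys orbT.
have m1 : measurable ([set x] : set (measurableTypeR R)) by exact: measurable_set1.
have mD := measurableC m1.
have ms := measurable_seq_set s; have msC := measurableC ms.
set a := fine (nu [set x]); have aE : nu [set x] = a%:E by rewrite fineK// P1_fin.
have a0 : 0 <= a by exact: fine_ge0.
have a1 : a <= 1 by rewrite -lee_fin -aE; exact: probability_le1.
have DE : nu (~` [set x]) = (1 - a)%:E by rewrite probability_setC// aE.
have split A : measurable A -> nu A = (nu (A `&` ~` [set x]) + (a * (x \in A)%:R)%:E)%E.
  move=> mA; rewrite -setDE (measureDI nu mA m1); congr (_ + _)%E.
  have [xA|xA] := boolP (x \in A); rewrite ?mulr1 ?mulr0.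
    by rewrite setIC (_ : [set x] `&` A = [set x])//;
      apply/setIidPl => y ->; rewrite inE in xA.
  rewrite (_ : A `&` [set x] = set0) ?measure0//; apply/seteqP; split => // y [Ay /= yx].
  by move: xA; rewrite notin_setE => /(_ _); apply; rewrite -yx.
have sE : ~` [set` s] `&` ~` [set x] = ~` [set` x :: s].
  by rewrite set_mem_cons setCU setIC.
have [a_eq0|a_neq0] := eqVneq a 0.
  by apply: IH; rewrite split// sE nus a_eq0 mul0r adde0.
have [a_eq1|a_neq1] := eqVneq a 1.
  apply: (fin_supported_dirac xK) => A mA; rewrite split// a_eq1 mul1r P1_diracE.
  rewrite (_ : nu (A `&` ~` [set x]) = 0%E) ?add0e//.
  apply/eqP; rewrite eq_le measure_ge0 andbT.
  have -> : (0%E : \bar R) = nu (~` [set x]) by rewrite DE a_eq1 subrr.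
  by apply: le_measure => //; rewrite inE//; exact: measurableI.
have a_gt0 : 0 < a by rewrite lt_neqAle eq_sym a_neq0.
have a_lt1 : a < 1 by rewrite lt_neqAle a_neq1.
have D0 : (0 < nu (~` [set x]))%E by rewrite DE lte_fin subr_gt0.
apply: (@fin_supported_mix _ _ nu (P1_cond mD D0) a x) => //; first by rewrite a_gt0.
  by apply: IH; rewrite P1_condE sE nus mul0e.
move=> A mA; rewrite fine_mix ?a0//.
rewrite P1_condE DE P1_diracE split//.
have mAD : measurable (A `&` ~` [set x]) by exact: measurableI.
rewrite -(fineK (P1_fin nu mAD)) -EFinM -EFinD /=; congr (_%:E).
by field; rewrite subr_eq0 eq_sym.
Qed.

Lemma seq_bounded (R : realType) (s : seq R) :
  exists2 K, 0 < K & forall x, x \in s -> - K <= x <= K.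
Proof.
elim: s => [|x s [K K0 sK]]; first by exists 1.
exists (K + `|x|); first by rewrite ltr_wpDr.
have := normr_ge0 x; have := ler_norm x; have := ler_norm (- x); rewrite normrN => h1 h2 h3.
by move=> y; rewrite inE => /orP[/eqP ->|/sK /andP[? ?]]; apply/andP; split; lra.
Qed.

(** The radius [K] comes from the range of [T], so one [K] serves both endpoints of a segment. *)
Lemma fin_supported_push (R : realType) (T : measurableTypeR R -> measurableTypeR R)
    (mT : measurable_fun setT T) (T_le : forall x, `|T x| <= `|x|) :
  finite_set (range T) ->
  exists2 K, 0 < K & forall m : P1 R, fin_supported K (P1_push mT T_le m).
Proof.
move=> /finite_seqP[s sE]; have [K K0 sK] := seq_bounded s.
exists K => // m; apply: (fin_supported_seq sK).
rewrite P1_pushE -sE (_ : _ @^-1` _ = set0) ?measure0//.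
by apply/seteqP; split => // x /= nx; apply: nx; exists x.
Qed.

(** * Passage to the limit *)

Section limit.
Context {R : realType} (H : P1 R -> R -> R).
Hypothesis H_C01 : class_C01 H.
Variables (T : nat -> measurableTypeR R -> measurableTypeR R).
Hypotheses (mT : forall n, measurable_fun setT (T n)) (T_le : forall n x, `|T n x| <= `|x|).
Hypothesis T_cvg : forall x, T ^~ x @ \oo --> x.

Let push n := P1_push (mT n) (T_le n).

Lemma cvg_mix_push t (m0 m : P1 R) : 0 <= t <= 1 ->
  mix_push mT T_le n t m0 m @[n --> \oo] --> mix t m0 m.
Proof.
move=> t01 A /(near_mix_push mT T_le T_cvg t01)[[/= U V] [tU V_oo] UV].
apply: (filterS _ V_oo) => n Vn; apply: (UV (t, n)) => //; split => //.
exact: nbhs_singleton.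
Qed.

Lemma cvg_push m (f : P1 R -> R) : continuous f -> f (push n m) @[n --> \oo] --> f m.
Proof.
move=> cf; have i0 : 0 <= (0 : R) <= 1 by rewrite lexx ler01.
have h := cvg_comp _ _ (@cvg_mix_push 0 m m i0) (cf _).
rewrite -(continuous_eqm cf (eqm_mix0 m m)).
apply: cvg_trans h; apply: near_eq_cvg; apply: nearW => n /=.
by apply: continuous_eqm => //; exact: eqm_mix0.
Qed.

Variables m0 m : P1 R.

Lemma mix_push_dominated : exists2 C : R, 0 < C & forall n t x, 0 <= t <= 1 ->
  `|H (mix_push mT T_le n t m0 m) x| <= C * (1 + `|x|).
Proof.
have [_ _ H3 _] := H_C01.
have [C C0 HC] := H3 _ (@compact_mix_push _ T mT T_le T_cvg m0 m).
by exists C => // n t x t01; apply: HC; right; exists n => //; exists t.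
Qed.

Let integrable_dom (C : R) (nu : P1 R) :
  nu.-integrable setT (fun x => (C%:E * (cst 1 x + `|x|%:E))%E).
Proof.
apply: integrableZl => //; apply: integrableD => //; last exact: integrable_normr.
exact: finite_measure_integrable_cst.
Qed.

Let dom_le C (y x : R) : 0 < C -> `|y| <= `|x| -> C * (1 + `|y|) <= C * (1 + `|x|).
Proof. by move=> C0 yx; apply: ler_wpM2l; [exact: ltW|rewrite lerD2l]. Qed.

Let integral_push n t nu : 0 <= t <= 1 ->
  (\int[push n nu]_x (H (mix_push mT T_le n t m0 m) x)%:E =
   \int[nu]_x (H (mix_push mT T_le n t m0 m) (T n x))%:E)%E.
Proof.
move=> t01; have [C C0 HC] := mix_push_dominated.
have mH : measurable_fun [set: measurableTypeR R] (EFin \o H (mix_push mT T_le n t m0 m)).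
  by apply/measurable_EFinP; exact: C01_measurable_r.
apply: (@integral_P1_push _ _ (mT n) (T_le n) nu _ mH).
apply: le_integrable (integrable_dom C nu) => //.
  exact: measurableT_comp.
move=> x _ /=; rewrite lee_fin [leRHS]ger0_norm.
  by apply: (le_trans (HC n t _ t01)); exact: dom_le.
by rewrite mulr_ge0 ?addr_ge0// ltW.
Qed.

Lemma integral_push_bound (C : R) n t (nu : P1 R) : 0 < C -> 0 <= t <= 1 ->
  (forall n t x, 0 <= t <= 1 -> `|H (mix_push mT T_le n t m0 m) x| <= C * (1 + `|x|)) ->
  (`|\int[push n nu]_x (H (mix_push mT T_le n t m0 m) x)%:E| <=
   \int[nu]_x (C%:E * (cst 1 x + `|x|%:E)))%E.
Proof.
move=> C0 t01 HC; rewrite integral_push//.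
have mH : measurable_fun [set: measurableTypeR R]
    (fun x => (H (mix_push mT T_le n t m0 m) (T n x))%:E).
  by apply/measurable_EFinP; apply: measurableT_comp => //; exact: C01_measurable_r.
apply: (le_trans (le_abse_integral _ _ mH)) => //.
apply: ge0_le_integral => //.
- exact: measurableT_comp.
- exact: (measurable_int _ (integrable_dom C nu)).
- move=> x _ /=; rewrite lee_fin; apply: (le_trans (HC n t _ t01)); exact: dom_le.
Qed.

(** A change of variables moves the dependence on [n] from the measure to the integrand. Joint
    continuity of [H] gives pointwise convergence, and the uniform growth constant, with
    [|T n x| <= |x|], gives domination. *)
Lemma cvg_integral_push (t : R) (nu : P1 R) : 0 <= t <= 1 ->
  (\int[push n nu]_x (H (mix_push mT T_le n t m0 m) x)%:E @[n --> \oo] -->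
   \int[nu]_x (H (mix t m0 m) x)%:E)%E.
Proof.
move=> t01; have [C C0 HC] := mix_push_dominated.
under eq_fun do rewrite integral_push//.
have [] // := @dominated_convergence _ _ _ nu setT measurableT
  (fun n x => (H (mix_push mT T_le n t m0 m) (T n x))%:E)
  (fun x => (H (mix t m0 m) x)%:E) _ _ _ _ (integrable_dom C nu) _.
- by move=> n; apply/measurable_EFinP; apply: measurableT_comp => //; exact: C01_measurable_r.
- by apply/measurable_EFinP; exact: C01_measurable_r.
- apply: aeW => x _; apply: cvg_EFin; first exact: nearW.
  have c : (mix_push mT T_le n t m0 m, T n x : R) @[n --> \oo] --> (mix t m0 m, x : R).
    have cx : (T n x : R) @[n --> \oo] --> (x : R) by exact: T_cvg.
    exact: (cvg_pair (@cvg_mix_push t m0 m t01) cx).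
  exact: (cvg_comp _ _ c (@C01_continuous _ _ H_C01 (mix t m0 m, x))).
- apply: aeW => x n _ /=; rewrite lee_fin.
  by apply: (le_trans (HC n t _ t01)); exact: dom_le.
Qed.

End limit.

Theorem theorem1p11 (R : realType) (F : P1 R -> R) (H : P1 R -> R -> R)
    (F_cont : continuous F)
    (H_C01 : class_C01 H)
    (F_lip : forall K : R, 0 < K -> W1_lipschitz_on (P1_supported K) F)
    (F_dawson : forall K : R, 0 < K -> uniformly_dawson_differentiable K F H)
    (H_centered : forall (K : R) (m : P1 R), 0 < K -> P1_supported K m ->
       (\int[m]_x (H m x)%:E = 0)%E) :
  canonical_derivative F H.
Proof.
have [T [mT T_le T_fin T_cvg]] := simple_approximation_id R.
have T_supp n := fin_supported_push (mT n) (T_le n) (T_fin n).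
have i0 : 0 <= (0 : R) <= 1 by rewrite lexx ler01.
split; first split.
- exact: (continuous_borel_measurable (C01_continuous H_C01)).
- by have [_ _ ? _] := H_C01.
- move=> m m0.
  pose push n := P1_push (mT n) (T_le n).
  pose g_ n (t : R) := (\int[push n m]_x (H (mix t (push n m0) (push n m)) x)%:E
    - \int[push n m0]_x (H (mix t (push n m0) (push n m)) x)%:E)%E.
  pose g (t : R) := (\int[m]_x (H (mix t m0 m) x)%:E - \int[m0]_x (H (mix t m0 m) x)%:E)%E.
  pose D := `[0%R, 1%R]%classic : set (measurableTypeR R).
  have mD : measurable D by exact: measurable_itv.
  (* The radius [K] may depend on [n], as the assumptions on [F] and [H] hold for every [K]. *)
  have ftc n : (F (push n m) - F (push n m0))%:E =
      (\int[lebesgue_measure]_(t in D) g_ n t)%E.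
    have [K K0 supp] := T_supp n.
    apply: (fin_supported_ftc F_cont H_C01 (F_dawson K K0) _ (supp m0) (supp m)).
    by move=> mu; exact: H_centered.
  have mg n : measurable_fun D (g_ n).
    have [K K0 supp] := T_supp n.
    exact: (measurable_fin_supported_derivative H_C01 (supp m0) (supp m)).
  have g_cvg t : D t -> g_ ^~ t @ \oo --> g t.
    rewrite /D /= in_itv /= => t01.
    have c1 := @cvg_integral_push _ _ H_C01 _ mT T_le T_cvg m0 m t m t01.
    have c0 := @cvg_integral_push _ _ H_C01 _ mT T_le T_cvg m0 m t m0 t01.
    apply: cvgeB c1 c0; apply: fin_num_adde_defl; rewrite ?fin_numN.
    by apply: integrable_fin_num => //; exact: C01_integrable.
  have [C C0 HC] := mix_push_dominated H_C01 mT T_le T_cvg m0 m.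
  pose B (nu : P1 R) := (\int[nu]_x (C%:E * (cst 1 x + `|x|%:E)))%E.
  have Bfin nu : B nu \is a fin_num.
    apply: integrable_fin_num => //; apply: integrableZl => //.
    apply: integrableD => //; last exact: integrable_normr.
    exact: finite_measure_integrable_cst.
  (* Dominated convergence now in [t]: the bound is constant, hence integrable on [0, 1]. *)
  have [] // := @dominated_convergence _ _ _ (@lebesgue_measure R) D mD g_ g
    (cst (B m + B m0)%E) mg _ _ _ _.
  + by apply: emeasurable_fun_cvg; [exact: mg|exact: g_cvg].
  + exact: aeW.
  + rewrite -(fineK (Bfin m)) -(fineK (Bfin m0)) -EFinD.
    apply: continuous_compact_integrable; first exact: segment_compact.
    by apply: continuous_subspaceT => ?; exact: cvg_cst.
  + apply: aeW => t n; rewrite /D /= in_itv /= => t01.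
    apply: (le_trans (lee_abs_sub _ _)).
    by apply: leeD; exact: (@integral_push_bound _ _ H_C01 _ mT T_le T_cvg
      m0 m C n t _ C0 t01 HC).
  move=> _ _ int_cvg.
  apply: (cvg_unique (@ereal_hausdorff R) _ int_cvg).
  have F_cvg : (F (push n m) - F (push n m0))%:E @[n --> \oo] --> (F m - F m0)%:E.
    apply: cvg_EFin; first exact: nearW.
    by apply: cvgB; exact: (cvg_push mT T_le T_cvg).
  by apply: cvg_trans F_cvg; apply: near_eq_cvg; apply: nearW => n /=; rewrite -ftc.
(* Centring is known for the push-forwards of [m], which have bounded support. It passes to the
   limit through mixtures of weight 0 of a measure with itself. *)
- move=> m.
  have c := @cvg_integral_push _ _ H_C01 _ mT T_le T_cvg m m 0 m i0.
  have H_eqm (x : R) mu nu : P1_eqm mu nu -> H mu x = H nu x.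
    by have [_ H2 _ _] := H_C01; exact: (continuous_eqm (H2 x)).
  have -> : (\int[m]_x (H m x)%:E = \int[m]_x (H (mix 0 m m) x)%:E)%E.
    by apply: eq_integral => x _; rewrite (H_eqm _ _ _ (eqm_mix0 m m)).
  apply: (cvg_unique (@ereal_hausdorff R) c).
  apply: cvg_near_cst; apply: nearW => n.
  have [K K0 supp] := T_supp n.
  rewrite -(H_centered K _ K0 (fin_supported_P1_supported (supp m))).
  by apply: eq_integral => x _; congr EFin; apply: H_eqm; exact: eqm_mix0.
Qed.
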